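(* Let $t,m$ be positive integers with $2^t-1-m-\binom{m}{2}>0$, let $n=2^t-1-\binom{m}{2}$ (so $1+n+\binom{m}{2}=2^t$), and let $\pi=(\pi_1,\dots,\pi_n)$ be the vector of weights with $\pi_i=1$ for $1\le i\le m$ and $\pi_i=2$ for $m<i\le n$. Let $\mathcal{H}$ be the family of all $t\times n$ binary matrices with the following properties: (1) all columns are nonzero and no column is repeated; (2) the sum of any two distinct columns among the first $m$ columns does not appear among the last $n-m$ columns; (3) the sum of any two or three distinct columns among the first $m$ columns does not appear among the first $m$ columns. If $H$ is a parity check matrix of a $2$-perfect linear $\pi$-code $C\subset\mathbb{F}_2^n$, then $H\in\mathcal{H}$. Furthermore, any code having some $H\in\mathcal{H}$ as a parity check matrix is a $2$-perfect linear $\pi$-code.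
   Context: For a vector of positive integer weights $\pi=(\pi_1,\dots,\pi_n)$, the $\pi$-weight of $\mathbf{x}=(x_1,\dots,x_n)\in\mathbb{F}_2^n$ is $w_\pi(\mathbf{x})=\sum_{i=1}^n\pi_i x_i$ (with the entries $x_i$ regarded as integers $0,1$), the $\pi$-distance is $d_\pi(\mathbf{x},\mathbf{y})=w_\pi(\mathbf{x}-\mathbf{y})$, and $S_\pi(\mathbf{x};r)=\{\mathbf{y}\in\mathbb{F}_2^n: d_\pi(\mathbf{x},\mathbf{y})\le r\}$. A subset $C\subset\mathbb{F}_2^n$ is an $r$-perfect $\pi$-code if the spheres $S_\pi(\mathbf{c};r)$, $\mathbf{c}\in C$, are mutually disjoint and their union is $\mathbb{F}_2^n$; it is linear if it is an $\mathbb{F}_2$-subspace of $\mathbb{F}_2^n$. A parity check matrix of a linear code $C\subset\mathbb{F}_2^n$ of dimension $n-s$ is an $s\times n$ matrix $H$ over $\mathbb{F}_2$ with $C=\{\mathbf{c}\in\mathbb{F}_2^n: H\mathbf{c}^T=\mathbf{0}\}$. *)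

(* Defs.v *)
From mathcomp Require Import all_boot all_order all_algebra.

Set Implicit Arguments.
Unset Strict Implicit.
Unset Printing Implicit Defensive.

Import GRing.Theory.
Local Open Scope ring_scope.

Definition pi_weight (n : nat) (pi : 'I_n -> nat) (x : 'rV['F_2]_n) : nat :=
  (\sum_(i < n) pi i * nat_of_ord (x ord0 i))%N.

Definition pi_dist (n : nat) (pi : 'I_n -> nat) (x y : 'rV['F_2]_n) : nat :=
  pi_weight pi (x - y).

Definition pi_sphere (n : nat) (pi : 'I_n -> nat) (x : 'rV['F_2]_n) (r : nat) :
    {set 'rV['F_2]_n} :=
  [set y | (pi_dist pi x y <= r)%N].

Definition perfect_code (n : nat) (pi : 'I_n -> nat) (r : nat)
    (C : {set 'rV['F_2]_n}) : Prop :=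
  {in C &, forall c c', c != c' ->
     [disjoint pi_sphere pi c r & pi_sphere pi c' r]}
  /\ \bigcup_(c in C) pi_sphere pi c r = [set: 'rV['F_2]_n].

Definition linear_code (n : nat) (C : {set 'rV['F_2]_n}) : Prop :=
  submod_closed C.

(* The dimension of the span of C, which is C itself when C is linear. *)
Definition code_dim (n : nat) (C : {set 'rV['F_2]_n}) : nat :=
  \dim <<enum C>>%VS.

Definition null_code (s n : nat) (H : 'M['F_2]_(s, n)) : {set 'rV['F_2]_n} :=
  [set c : 'rV['F_2]_n | H *m c^T == 0].

(* The dimension n - s is written additively to avoid truncated subtraction. *)
Definition parity_check_matrix (s n : nat) (H : 'M['F_2]_(s, n))
    (C : {set 'rV['F_2]_n}) : Prop :=
  [/\ linear_code C, (code_dim C + s)%N = n & C = null_code H].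

(* Indices are 0-based: the first m coordinates are those with i < m. *)
Definition weights12 (m n : nat) (i : 'I_n) : nat := if (i < m)%N then 1 else 2.

(* Distinct columns are columns at distinct positions; since the first clause
   makes the columns pairwise different, they are then distinct vectors too. *)
Definition in_family (m t n : nat) (H : 'M['F_2]_(t, n)) : Prop :=
  [/\ (forall j, col j H != 0) /\ injective (fun j => col j H),
      (forall i j k : 'I_n, (i < m)%N -> (j < m)%N -> i != j -> (m <= k)%N ->
         col i H + col j H != col k H)
    & (forall i j l : 'I_n, (i < m)%N -> (j < m)%N -> i != j -> (l < m)%N ->
         col i H + col j H != col l H)
      /\ (forall i j k l : 'I_n, (i < m)%N -> (j < m)%N -> (k < m)%N ->
         uniq [:: i; j; k] -> (l < m)%N ->
         col i H + col j H + col k H != col l H)].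

(* Main.v *)
Require Import Defs.
From mathcomp Require Import all_boot all_order all_algebra all_field.
From mathcomp Require Import zify.

(** Translating by codewords identifies the space with (ball around [0]) x C
    when C is perfect, and by linearity C is perfect iff the syndrome map
    [x |-> H x^T] is injective on the ball and attains on it all of its values.
    A vector of weight at most 2 is the indicator of the empty set, of a
    singleton, or of a pair of positions among the first m, so the ball has
    [1 + n + 'C(m, 2) = 2 ^ t] elements and injectivity of the syndrome on it
    is the defining property of the family of matrices.  Since there are [2 ^ t]
    syndromes, injectivity already forces surjectivity; counting
    [#|ball| * #|C| = 2 ^ n] settles the dimensions. *)

Set Implicit Arguments.
Unset Strict Implicit.
Unset Printing Implicit Defensive.

Import GRing.Theory.
Local Open Scope ring_scope.

Lemma oppmx_F2 p q (A : 'M['F_2]_(p, q)) : - A = A.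
Proof. by apply/matrixP => i j; rewrite mxE oppr_pchar2 // pchar_Fp. Qed.

Lemma addmx_F2 p q (A : 'M['F_2]_(p, q)) : A + A = 0.
Proof. by rewrite -[X in _ + X]oppmx_F2 subrr. Qed.

(** * Perfect codes and syndromes, for arbitrary weights and radius *)

Section Codes.

Variables (n : nat) (pi : 'I_n -> nat) (r : nat).
Implicit Types (x y c : 'rV['F_2]_n) (C : {set 'rV['F_2]_n}).

Lemma mem_pi_sphere x y : (y \in pi_sphere pi x r) = (x - y \in pi_sphere pi 0 r).
Proof. by rewrite !inE /pi_dist sub0r !oppmx_F2. Qed.

Lemma card_perfect_code C :
  perfect_code pi r C -> (#|pi_sphere pi 0 r| * #|C| = 2 ^ n)%N.
Proof.
case=> disjC coverC; rewrite -cardsX.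
rewrite -(@card_in_imset _ _ (fun p : 'rV['F_2]_n * 'rV['F_2]_n => p.2 - p.1)).
  rewrite -[in RHS](mul1n n) -[2%N in RHS](card_Fp (p:=2)) // -card_mx -cardsT.
  apply: eq_card => y; rewrite [RHS]inE; apply/imsetP.
  have : y \in \bigcup_(c in C) pi_sphere pi c r by rewrite coverC inE.
  case/bigcupP=> c cC; rewrite mem_pi_sphere => By.
  by exists (c - y, c); rewrite ?in_setX /= ?By ?subKr.
case=> b c [b' c']; rewrite !in_setX /= => /andP[Bb cC] /andP[Bb' c'C] E.
(* If [c] and [c'] differed, the common value [c - b = c' - b'] would lie in both of their
   spheres. *)
have [Ec|neq] := eqVneq c c'; first by move: E; rewrite Ec => /addrI/oppr_inj->.
have /pred0P/(_ (c - b))/= := disjC c c' cC c'C neq.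
by rewrite !(mem_pi_sphere _ (c - b)) {2}E !subKr Bb Bb'.
Qed.

Lemma card_linear_code C : linear_code C -> #|C| = (2 ^ code_dim C)%N.
Proof.
case=> C0 Clin; transitivity (#|'F_2| ^ code_dim C)%N; last by rewrite card_Fp.
(* Linearity makes [C] equal to its span: combinations of elements of [C] stay in [C]. *)
rewrite /code_dim -card_vspace; apply: eq_card => x.
apply/idP/idP=> [xC | /coord_span->].
  by rewrite memv_span // mem_enum.
elim/big_rec: _ => // i y _ yC; apply: Clin; last by [].
by rewrite -mem_enum mem_nth // -cardE.
Qed.

Section Syndrome.

Variables (s : nat) (H : 'M['F_2]_(s, n)).

Let syndrome x := H *m x^T.

Lemma mem_null_codeB x y : (x - y \in null_code H) = (syndrome x == syndrome y).
Proof. by rewrite inE linearB /= mulmxBr subr_eq0. Qed.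

Lemma linear_null_code : linear_code (null_code H).
Proof.
split=> [|a x y]; first by rewrite inE trmx0 mulmx0.
rewrite !inE => /eqP Hx /eqP Hy.
by rewrite linearD linearZ /= mulmxDr -scalemxAr Hx Hy scaler0 addr0.
Qed.

(** Two vectors have the same syndrome exactly when they differ by a codeword. So a collision [x],
    [y] in the ball puts [x] in the spheres around both [0] and [x - y], and a vector [y] of the
    ball with the syndrome of [x] gives a codeword [x - y] whose sphere contains [x]. *)
Lemma perfect_null_codeP : perfect_code pi r (null_code H) <->
  {in pi_sphere pi 0 r &, injective syndrome} /\
  forall x, exists2 y, y \in pi_sphere pi 0 r & syndrome y = syndrome x.
Proof.
split=> [[disjC coverC] | [inj surj]]; split.
- move=> x y Bx By /eqP; rewrite -mem_null_codeB => xyC.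
  have C0 : 0 \in null_code H by case: linear_null_code.
  have [/subr0_eq//|neq] := eqVneq (x - y) 0.
  have /pred0P/(_ x)/= := disjC _ _ xyC C0 neq.
  by rewrite mem_pi_sphere addrAC subrr sub0r oppmx_F2 By Bx.
- move=> x; have : x \in \bigcup_(c in null_code H) pi_sphere pi c r.
    by rewrite coverC inE.
  case/bigcupP=> c; rewrite mem_pi_sphere => cC Bcx; exists (c - x) => //.
  (* In characteristic 2, [c - x - x] is the codeword [c]. *)
  by apply/eqP; rewrite -mem_null_codeB -[X in _ - X]oppmx_F2 opprK subrK.
- move=> c c' cC c'C; apply: contraR => /pred0Pn[y /andP[/=]].
  rewrite !(mem_pi_sphere _ y) => By By'; apply/eqP/(@addIr _ (- y))/inj => //.
  by apply/eqP; rewrite -mem_null_codeB opprB addrA subrK mem_null_codeB;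
    move: cC c'C; rewrite !inE /syndrome => /eqP-> /eqP->.
- apply/setP=> x; rewrite inE; apply/bigcupP; have [y By Hy] := surj x.
  exists (x - y); first by rewrite mem_null_codeB Hy.
  by rewrite mem_pi_sphere addrAC subrr sub0r oppmx_F2.
Qed.

End Syndrome.

End Codes.

(** * Binary vectors as sets of positions *)

Section IndicatorVectors.

Variable n : nat.
Implicit Type A : {set 'I_n}.

Definition indic_row A : 'rV['F_2]_n := \row_i (i \in A)%:R.

Lemma indic_row_bij : bijective indic_row.
Proof.
exists (fun x : 'rV['F_2]_n => [set i | x 0 i != 0]) => [A | x].
  by apply/setP=> i; rewrite inE mxE; case: (i \in A).
apply/rowP=> i; rewrite mxE inE.
by case: (x 0 i) => [[|[|k]] //= lt_k2]; apply/val_inj.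
Qed.

Lemma pi_weight_indic (pi : 'I_n -> nat) A :
  pi_weight pi (indic_row A) = (\sum_(i in A) pi i)%N.
Proof.
rewrite /pi_weight [RHS]big_mkcond; apply: eq_bigr => i _; rewrite mxE.
by case: (i \in A); rewrite ?muln1 ?muln0.
Qed.

Lemma mulmx_indic s (H : 'M['F_2]_(s, n)) A :
  H *m (indic_row A)^T = \sum_(i in A) col i H.
Proof.
apply/colP=> k; rewrite !mxE summxE [RHS]big_mkcond; apply: eq_bigr => i _.
by rewrite !mxE; case: (i \in A); rewrite ?mulr1 ?mulr0.
Qed.

End IndicatorVectors.

(** * The ball of radius 2 for weights 1 and 2 *)

Section WeightsOneTwo.

Variables m n : nat.
Implicit Type A : {set 'I_n}.

Definition low_pairs : {set {set 'I_n}} :=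
  [set A : {set 'I_n} | A \subset [set i : 'I_n | (i < m)%N] & #|A| == 2%N].

(** These are the supports of the vectors of weight at most 2. *)
Definition light_sets : {set {set 'I_n}} :=
  (set0 |: [set [set i] | i : 'I_n]) :|: low_pairs.

Lemma low_pairsP A :
  reflect (exists i j : 'I_n, [/\ (i < m)%N, (j < m)%N, i != j & A = [set i; j]])
          (A \in low_pairs).
Proof.
rewrite inE; apply: (iffP andP) => [[/subsetP sAm /cards2P[i [j [neq EA]]]] | ].
  exists i, j; split=> //.
    by have := sAm i; rewrite EA !inE eqxx => /(_ isT).
  by have := sAm j; rewrite EA !inE eqxx orbT => /(_ isT).
case=> i [j [im jm neq ->]]; rewrite cards2 neq; split=> //.
by apply/subsetP=> k; rewrite !inE => /orP[]/eqP->.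
Qed.

Lemma light_setsP A : reflect
  [\/ A = set0, exists i, A = [set i]
    | exists i j : 'I_n, [/\ (i < m)%N, (j < m)%N, i != j & A = [set i; j]]]
  (A \in light_sets).
Proof.
rewrite !in_setU in_set1; apply: (iffP orP).
  case=> [/orP[/eqP | /imsetP[i _ ->]] | /low_pairsP]; first exact: Or31.
    by apply: Or32; exists i.
  exact: Or33.
case=> [-> | [i ->] | /low_pairsP ?]; [left | left | by right].
  by rewrite eqxx.
by rewrite imset_f ?orbT.
Qed.

Lemma card_light_sets : (m <= n)%N -> #|light_sets| = (1 + n + 'C(m, 2))%N.
Proof.
move=> le_mn; rewrite /light_sets cardsU cardsU1 card_imset; last exact: set1_inj.
rewrite cards_draws cardT size_enum_ord.
have -> : #|[set i : 'I_n | (i < m)%N]| = m.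
  by rewrite -sum1dep_card -(big_ord_widen n (fun=> 1%N) le_mn) sum1_card card_ord.
have -> : set0 \notin [set [set i] | i : 'I_n].
  by apply/imsetP=> -[i _ /setP/(_ i)]; rewrite !inE eqxx.
(* No overlap to subtract: the empty set and the singletons have fewer than two elements. *)
rewrite (_ : _ :&: _ = set0) ?cards0 ?subn0 //.
apply/setP=> A; rewrite in_set0 in_setI in_setU1.
have [cA2 | cA2] := eqVneq #|A| 2; last first.
  by rewrite [A \in low_pairs]inE (negPf cA2) !andbF.
apply/negP=> /andP[/orP[/eqP A0 | /imsetP[i _ A1]] _]; move: cA2.
  by rewrite A0 cards0.
by rewrite A1 cards1.
Qed.

Lemma light_sets_weight A :
  (A \in light_sets) = (\sum_(i in A) weights12 m i <= 2)%N.
Proof.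
have wt_gt0 (i : 'I_n) : (0 < weights12 m i)%N by rewrite /weights12; case: ifP.
apply/light_setsP/idP=> [[-> | [i ->] | [i [j [im jm neq ->]]]] | wA].
- by rewrite big_set0.
- by rewrite big_set1 /weights12; case: ifP.
- by rewrite big_setU1 ?inE // big_set1 /weights12 im jm.
(* All weights are at least 1, so weight bounds size; in a pair, a position of weight 2 would
   already give a total of at least 3. *)
have le2 : (#|A| <= 2)%N.
  by rewrite -sum1_card; apply: leq_trans wA; apply: leq_sum.
case cA: #|A| le2 => [|[|[|//]]] _.
- by apply: Or31; apply/cards0_eq.
- by apply: Or32; apply/cards1P/eqP.
apply: Or33; have /cards2P[i [j [neq EA]]] : #|A| == 2%N by rewrite cA.
exists i, j; move: wA; rewrite EA big_setU1 ?inE // big_set1 /weights12.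
by do 2!case: ifP => ?; split.
Qed.

Lemma pi_sphere_weights12 :
  pi_sphere (@weights12 m n) 0 2 = [set indic_row A | A in light_sets].
Proof.
have [g indicK gK] := indic_row_bij n; apply/setP=> x; rewrite -(gK x).
rewrite (mem_imset _ _ (can_inj indicK)) light_sets_weight -pi_weight_indic.
by rewrite inE /pi_dist sub0r oppmx_F2.
Qed.

Lemma card_pi_sphere_weights12 : (m <= n)%N ->
  #|pi_sphere (@weights12 m n) 0 2| = (1 + n + 'C(m, 2))%N.
Proof.
move=> le_mn; rewrite pi_sphere_weights12 card_imset ?card_light_sets //.
exact/bij_inj/indic_row_bij.
Qed.

(** * Injectivity of the syndrome on the ball, read on the columns *)

Section Columns.

Variables (s : nat) (H : 'M['F_2]_(s, n)).

Let colsum A := \sum_(i in A) col i H.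

Let colsum1 i : colsum [set i] = col i H.
Proof. exact: big_set1. Qed.

Let colsum2 i j : i != j -> colsum [set i; j] = col i H + col j H.
Proof. by move=> neq; rewrite /colsum big_setU1 ?inE // big_set1. Qed.

Lemma syndrome_inj_colsum :
  {in pi_sphere (@weights12 m n) 0 2 &, injective (fun x => H *m x^T)} <->
  {in light_sets &, injective colsum}.
Proof.
rewrite pi_sphere_weights12; split=> inj.
  move=> A B lA lB; rewrite /colsum -!mulmx_indic.
  by move=> /inj/(bij_inj (indic_row_bij n))->//; apply: imset_f.
by move=> _ _ /imsetP[A lA ->] /imsetP[B lB ->]; rewrite !mulmx_indic => /inj->.
Qed.

(** Each clause excludes collisions by the sizes of the two sets: 0 and 1 give a zero column; 0 and
    2, or 1 and 1, a repeated column; 1 and 2 a column that is a sum of two low ones. Two pairs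
    sharing a position cancel to a repeated column; otherwise three low columns sum to a fourth. *)
Lemma in_family_colsum_inj :
  in_family m H -> {in light_sets &, injective colsum}.
Proof.
case=> -[nz inj] low2_high [low2 low3] A B lA lB.
have pair_neq0 i j : i != j -> col i H + col j H != 0.
  apply: contra => /eqP/(congr1 (+%R^~ (col j H))).
  by rewrite -addrA addmx_F2 addr0 add0r => /inj->.
have pair_neq1 (i j k : 'I_n) : (i < m)%N -> (j < m)%N -> i != j ->
    col i H + col j H != col k H.
  by move=> im jm; have [km|mk] := ltnP k m => neq; [apply: low2 | apply: low2_high].
wlog le_AB : A B lA lB / (#|A| <= #|B|)%N.
  move=> wl; have [le|/ltnW le] := leqP #|A| #|B|; first exact: wl.
  by move=> /esym/wl->.
case/light_setsP: lA le_AB => [-> | [i ->] | [i [j [im jm ij ->]]]].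
- case/light_setsP: lB => [-> | [k ->] | [k [l [km lm kl ->]]]] _ //.
    by rewrite colsum1 /colsum big_set0 => /esym/eqP; rewrite (negPf (nz k)).
  by rewrite colsum2 // /colsum big_set0 => /esym/eqP; rewrite (negPf (pair_neq0 _ _ kl)).
- rewrite cards1; case/light_setsP: lB => [-> | [k ->] | [k [l [km lm kl ->]]]].
  + by rewrite cards0.
  + by rewrite !colsum1 => _ /inj->.
  by rewrite colsum1 colsum2 // => _ /esym/eqP; rewrite (negPf (pair_neq1 _ _ _ _ _ _)).
rewrite cards2 ij; case/light_setsP: lB => [-> | [k ->] | [k [l [km lm kl ->]]]].
- by rewrite cards0.
- by rewrite cards1.
rewrite !colsum2 // => _ E.
have [Ek|ik] := eqVneq i k; first by move: E; rewrite Ek => /addrI/inj->.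
have [Ek|jk] := eqVneq j k.
  by move: E; rewrite Ek addrC => /addrI/inj->; rewrite setUC.
have uniq_ijk : uniq [:: i; j; k] by rewrite /= !inE negb_or ij ik jk.
(* The three-column clause allows [l] to coincide with one of the summed positions, so [l] needs no
   further case analysis. *)
have /eqP[] := low3 i j k l im jm km uniq_ijk lm.
by rewrite E addrAC addmx_F2 add0r.
Qed.

Lemma colsum_inj_in_family :
  {in light_sets &, injective colsum} -> in_family m H.
Proof.
move=> inj.
have l0 : set0 \in light_sets by apply/light_setsP/Or31.
have l1 i : [set i] \in light_sets by apply/light_setsP/Or32; exists i.
have l2 (i j : 'I_n) : (i < m)%N -> (j < m)%N -> i != j -> [set i; j] \in light_sets.
  by move=> im jm ij; apply/light_setsP/Or33; exists i, j.
have col_inj : injective (fun j => col j H).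
  by move=> i j; rewrite -!colsum1 => /inj/set1_inj->.
have pair_neq1 (i j k : 'I_n) : (i < m)%N -> (j < m)%N -> i != j ->
    col i H + col j H != col k H.
  move=> im jm ij; rewrite -colsum2 // -colsum1; apply/eqP=> /inj EA.
  by have := cards1 k; rewrite -EA ?cards2 ?ij ?l1 ?l2.
split; last split; try by move=> *; apply: pair_neq1.
  split=> // j; apply/eqP => cj0.
  have /setP/(_ j) : [set j] = set0.
    by apply: inj; rewrite ?l0 ?l1 ?colsum1 // /colsum big_set0.
  by rewrite !inE eqxx.
move=> i j k l im jm km; rewrite /= !inE negb_or andbT => /andP[/andP[ij ik] jk] lm.
(* Moving [col k H] across compares two pairs. If [k = l], columns [i] and [j] coincide; if not, the
   pairs differ because [k] is neither [i] nor [j]. *)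
apply/eqP=> E; have {E} : col i H + col j H = col k H + col l H.
  by rewrite -E addrCA addmx_F2 addr0.
have [<-|kl] := eqVneq k l.
  rewrite addmx_F2 => /(congr1 (+%R^~ (col j H))).
  by rewrite -addrA addmx_F2 addr0 add0r => /col_inj/eqP; rewrite (negPf ij).
rewrite -!colsum2 // => /inj -/(_ (l2 _ _ im jm ij) (l2 _ _ km lm kl))/setP/(_ k).
by rewrite !inE eqxx ![k == _]eq_sym (negPf ik) (negPf jk).
Qed.

Lemma in_familyP : in_family m H <->
  {in pi_sphere (@weights12 m n) 0 2 &, injective (fun x => H *m x^T)}.
Proof.
split=> [/in_family_colsum_inj/syndrome_inj_colsum // |].
by move/syndrome_inj_colsum/colsum_inj_in_family.
Qed.

End Columns.

End WeightsOneTwo.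

Theorem theorem3p1 (t m n : nat) (ht : (0 < t)%N) (hm : (0 < m)%N)
    (htm : (0 < 2 ^ t - 1 - m - 'C(m, 2))%N)
    (hn : n = (2 ^ t - 1 - 'C(m, 2))%N) :
  (forall (s : nat) (H : 'M['F_2]_(s, n)) (C : {set 'rV['F_2]_n}),
     linear_code C -> perfect_code (@weights12 m n) 2 C ->
     parity_check_matrix H C ->
     exists e : s = t, in_family m (castmx (e, erefl n) H))
  /\
  (forall (H : 'M['F_2]_(t, n)) (C : {set 'rV['F_2]_n}),
     in_family m H -> C = null_code H ->
     [/\ parity_check_matrix H C, linear_code C
       & perfect_code (@weights12 m n) 2 C]).
Proof.
(* Positivity in [htm] ensures that none of the natural subtractions is truncated. *)
have [le_mn card_ball] : (m <= n)%N /\ (1 + n + 'C(m, 2) = 2 ^ t)%N.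
  by move: (2 ^ t)%N 'C(m, 2) htm hn => T Q; lia.
rewrite -card_pi_sphere_weights12 // in card_ball.
have dim_add C : linear_code C -> perfect_code (@weights12 m n) 2 C ->
    (code_dim C + t = n)%N.
  move=> linC /card_perfect_code; rewrite card_ball (card_linear_code linC).
  by rewrite -expnD addnC => /eqP; rewrite eqn_exp2l // => /eqP.
split=> [s H C linC perfC [_ dimC defC] | H C famH ->].
  (* Both [s] and [t] complement the dimension of [C] to [n]: [s] by definition of a parity check
     matrix, [t] by counting. *)
  have e : s = t by apply/(@addnI (code_dim C)); rewrite dimC dim_add.
  exists e; case: _ / e; rewrite castmx_id.
  by apply/in_familyP; move: perfC; rewrite defC => /perfect_null_codeP[].
have linC := linear_null_code H; have /in_familyP inj := famH.
have perfC : perfect_code (@weights12 m n) 2 (null_code H).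
  apply/perfect_null_codeP; split=> // x.
  suff /imsetP[y By ->] : H *m x^T \in [set H *m y^T | y in pi_sphere (@weights12 m n) 0 2].
    by exists y.
  (* By injectivity the image of the ball has [2 ^ t] elements, as many as there are column vectors
     of length [t]. *)
  rewrite (_ : [set _ | _ in _] = setT) ?inE //; apply/eqP.
  by rewrite eqEcard subsetT cardsT card_mx muln1 card_Fp // card_in_imset // card_ball /=.
by split=> //; split=> //; apply: dim_add.
Qed.
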